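(* Let $(\mathcal N,\mathcal O,\mathfrak l)$ be a plabic network containing a square with vertices $A,B,C,D$ in clockwise order, with $A,C$ trivalent white and $B,D$ trivalent black, and edges $h_1:A\to B$ of weight $\alpha_1$, $h_2:A\to D$ of weight $\alpha_2$, $h_3:B\to C$ of weight $\alpha_3$, $h_4:C\to D$ of weight $\alpha_4$; the remaining edges at these vertices are $e_1$ incoming at $A$, $e_2$ incoming at $B$, $e_3$ outgoing at $D$, $e_4$ outgoing at $C$. Perform the square move: the colours of the four vertices are switched, $h_1$ and $h_4$ are reversed (becoming $-h_1:B\to A$ and $-h_4:D\to C$), $h_2,h_3$ and all other edges keep their direction, the weights of $h_1,h_2,h_3,h_4$ become $$\tilde\alpha_1=\frac{\alpha_3\alpha_4}{\tilde\alpha_2},\quad\tilde\alpha_2=\alpha_2+\alpha_1\alpha_3\alpha_4,\quad\tilde\alpha_3=\frac{\alpha_2\alpha_3}{\tilde\alpha_2},\quad\tilde\alpha_4=\frac{\alpha_1\alpha_3}{\tilde\alpha_2},$$ and all other weights and the boundary conditions are unchanged. Let $F_j$ be the edge vector at $h_j$ before the move and $\tilde F_j$ the edge vector at the corresponding edge ($-h_1,h_2,h_3,-h_4$ for $j=1,2,3,4$) after the move. Then $$\tilde F_4=\tilde\alpha_4\alpha_3^{-1}(-1)^{\mathrm{int}(h_3)+\mathrm{int}(h_4)+\gamma_2(h_4)+\mathrm{wind}(h_3,h_4)+1}F_3+\tilde\alpha_4(-1)^{\mathrm{int}(h_4)+\gamma_2(h_4)}F_4,$$ $$\tilde F_2=\alpha_1(-1)^{\mathrm{int}(h_1)+\gamma_2(h_4)+\mathrm{wind}(h_2,-h_4)+\mathrm{wind}(h_3,h_4)+1}F_3+\alpha_2\alpha_4^{-1}(-1)^{1+\mathrm{int}(h_2)+\mathrm{int}(h_4)+\gamma_2(h_4)+\mathrm{wind}(h_2,-h_4)}F_4,$$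 $$\tilde F_1=\tilde\alpha_1(-1)^{\mathrm{int}(h_1)+\mathrm{wind}(-h_1,h_2)}\tilde F_2,$$ $$\tilde F_3=(-1)^{\mathrm{int}(h_3)+\mathrm{int}(h_4)+\gamma_2(h_4)+\mathrm{wind}(h_3,h_4)+1}\alpha_2\alpha_1^{-1}\tilde F_4.$$
   Context: Fix positive integers $k<n$. A plabic graph of type $(k,n)$ is a finite directed graph drawn planarly in a disk, with no component isolated from the boundary, such that: it has $n$ boundary vertices $b_1,\dots,b_n$ labelled clockwise, all on a common straight interval of the boundary of the disk, each of degree 1 (a boundary source if its edge is outgoing, a boundary sink if incoming; exactly $k$ are sources, indexed by $I=\{i_1<\dots<i_k\}$); all other (internal) vertices are strictly inside the disk and are bivalent or trivalent; each internal vertex either has exactly one incoming edge (white) or exactly one outgoing edge (black), bivalent vertices being assigned either colour. Edges are straight segments, regarded as vectors directed by the orientation $\mathcal O$. A plabic network is a plabic graph with positive edge weights $w_e$. The square is a face of the graph. A gauge ray direction $\mathfrak l$ is an oriented direction such that the ray in direction $\mathfrak l$ from any boundary vertex points inside the disk, no internal edge is parallel to $\mathfrak l$, and the rays starting at boundary vertices contain no internal vertices. The gauge rays are the rays $\mathfrak l_{i_r}$ starting at the boundary sources. For plane vectors $s(u,v)=+1,0,-1$ if $(u,v)$ is positively (counterclockwise) oriented, parallel, negatively oriented; $\gamma_2(e)=\frac{1-s(e,\mathfrak l)}2$. For consecutive directed edges, $\mathrm{wind}(e,f)=\pm1$ if $s(e,f)=s(e,\mathfrak l)=s(\mathfrak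 l,f)=\pm1$, and $0$ otherwise. $\mathrm{int}(e)$ is the number of intersections of $e$ with the gauge rays (the common starting point of $\mathfrak l_{i_r}$ and the edge at $b_{i_r}$ is not counted). System of edge vectors: given linearly independent vectors $B_j$ at the boundary sinks, the edge vectors are the unique solution of $E_{e_j}=(-1)^{\mathrm{int}(e_j)}w_{e_j}B_j$ at the edge $e_j$ ending at each boundary sink $b_j$; $E_e=(-1)^{\mathrm{int}(e)+\mathrm{wind}(e,f)}w_eE_f$ for each incoming edge $e$ at a bivalent or black vertex with outgoing edge $f$; $E_{e}=(-1)^{\mathrm{int}(e)+\mathrm{wind}(e,f)}w_{e}E_{f}+(-1)^{\mathrm{int}(e)+\mathrm{wind}(e,g)}w_{e}E_{g}$ at each trivalent white vertex with incoming edge $e$ and outgoing edges $f,g$. The edge vectors outside the square are the same before and after the move. *)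

(* Defs.v *)
From mathcomp Require Import all_boot all_order all_algebra.
From mathcomp Require Import all_classical all_reals.
From mathcomp Require Import topology normedtype convex.
Set Implicit Arguments.
Unset Strict Implicit.
Unset Printing Implicit Defensive.
Import Order.TTheory GRing.Theory Num.Theory.
Import numFieldNormedType.Exports.
Local Open Scope classical_set_scope.
Local Open Scope ring_scope.

Section Plane.
Context {R : realType}.
Implicit Types (u v l p q : (R * R)%type).

Definition cross u v : R := u.1 * v.2 - u.2 * v.1.

Definition orient u v : int := sgz (cross u v).

Definition gamma2 l u : int := ((1 - orient u l) %/ 2)%Z.

(* When the three signs agree, their common value is the winding; a common
   value 0 gives winding 0. *)
Definition wind l u v : int :=
  if (orient u v == orient u l) && (orient u l == orient l v)
  then orient u v else 0.

Definition segment p q : set (R * R) :=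
  [set p + t *: (q - p) | t in [set t : R | 0 <= t <= 1]].

(* (u.2, - u.1) is u turned clockwise by a right angle: F lies immediately to
   the right of the open segment walked from p to q. *)
Definition right_of (F : set (R * R)) p q :=
  let u := q - p in
  forall t, 0 < t < 1 ->
    \forall eps \near 0^'+, F (p + t *: u + eps *: (u.2, - u.1)).

(* A convex disk, so that a ray from a boundary point meets the disk in a
   segment.  A round disk has no straight boundary interval, hence general
   convex bodies are allowed. *)
Definition disk (D : set (R * R)) :=
  [/\ compact D, D° !=set0 &
      convex_set (D : set (convex_lmodType (R * R)%type))].

Definition frontier (D : set (R * R)) : set (R * R) := closure D `\` D°.

End Plane.

(* Raw data of a network with n boundary vertices; the colour of a boundary
   vertex is irrelevant. *)
Record network (R : realType) (n : nat) := Network {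
  vert : finType;
  edge : finType;
  src : edge -> vert;
  tgt : edge -> vert;
  bdry : 'I_n -> vert;
  white : pred vert;
  pos : vert -> (R * R)%type;
  weight : edge -> R }.

Section Networks.
Context {R : realType} {n : nat}.
Implicit Types (N : network R n) (D : set (R * R)) (l : (R * R)%type).

Definition internal N : pred (vert N) := [pred v | v \notin codom (@bdry _ _ N)].

Definition indeg N (v : vert N) := #|[pred e : edge N | tgt e == v]|.
Definition outdeg N (v : vert N) := #|[pred e : edge N | src e == v]|.
Definition deg N (v : vert N) := (indeg v + outdeg v)%N.

Definition source N : pred 'I_n := [pred j | outdeg (bdry N j) == 1%N].
Definition sink N : pred 'I_n := [pred j | indeg (bdry N j) == 1%N].

Definition adj N : rel (vert N) :=
  [rel u v | [exists e : edge N, ((src e == u) && (tgt e == v))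
                              || ((src e == v) && (tgt e == u))]].

Definition evec N (e : edge N) : (R * R)%type := pos (tgt e) - pos (src e).

Definition drawn N (e : edge N) : set (R * R) :=
  segment (pos (src e)) (pos (tgt e)).

Definition drawing N : set (R * R) := \bigcup_(e in [set: edge N]) drawn e.

Record plabic_network (k : nat) D N : Prop := {
  pn_disk : disk D;
  pn_bdry_inj : injective (@bdry _ _ N);
  pn_bdry_deg : forall j, deg (bdry N j) = 1%N;
  pn_sources : #|[pred j | source N j]| = k;
  pn_internal_deg : forall v : vert N, internal v -> deg v \in [:: 2%N; 3%N];
  pn_white : forall v : vert N, internal v -> white v -> indeg v = 1%N;
  pn_black : forall v : vert N, internal v -> ~~ white v -> outdeg v = 1%N;
  pn_connected : forall v : vert N, exists j, connect (@adj N) v (bdry N j);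
  (* the boundary vertices, in order, run along a straight interval [a, b] of
     the boundary of D with the inside of D on the right, i.e. clockwise *)
  pn_bdry_pos : exists a b : (R * R)%type,
    [/\ segment a b `<=` frontier D,
        (forall x, D° x -> cross (b - a) (x - a) < 0) &
        exists t : 'I_n -> R,
          [/\ forall j, 0 <= t j <= 1,
              forall i j : 'I_n, (i < j)%N -> t i < t j &
              forall j, pos (bdry N j) = a + t j *: (b - a)]];
  pn_internal_pos : forall v : vert N, internal v -> D° (pos v);
  pn_pos_inj : injective (@pos _ _ N);
  pn_noloop : forall e : edge N, src e != tgt e;
  pn_planar : forall (e f : edge N) (x : R * R), e != f ->
    drawn e x -> drawn f x ->
    exists v : vert N, [/\ x = pos v, v \in [:: src e; tgt e] &
                           v \in [:: src f; tgt f]];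
  pn_weight : forall e : edge N, 0 < weight e }.

(* An internal edge is one joining two internal vertices. *)
Record gauge_direction D N l : Prop := {
  gd_inside : forall j, \forall t \near 0^'+, D° (pos (bdry N j) + t *: l);
  gd_parallel : forall e : edge N, internal (src e) -> internal (tgt e) ->
    orient (evec e) l != 0;
  gd_vertex : forall j (v : vert N), internal v ->
    forall t : R, 0 <= t -> pos (bdry N j) + t *: l <> pos v }.

(* int(e): the rays are those starting at boundary sources, a ray meets an
   edge at most once, and 0 < t discards the starting point of the ray. *)
Definition crossings N l (e : edge N) : nat :=
  #|[pred j | source N j &&
      `[< exists2 t : R, 0 < t & drawn e (pos (bdry N j) + t *: l) >]]|.

(* E solves the linear relations with boundary conditions B at the sinks;
   uniqueness of the solution is a theorem and is not part of the predicate. *)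
Record edge_vectors (V : lmodType R) N l (B : 'I_n -> V) (E : edge N -> V) :
    Prop := {
  ev_sink : forall (j : 'I_n) (e : edge N), tgt e = bdry N j ->
    E e = ((-1) ^+ crossings l e * weight e) *: B j;
  ev_single : forall e f : edge N,
    internal (tgt e) -> deg (tgt e) = 2%N \/ ~~ white (tgt e) ->
    src f = tgt e ->
    E e = ((-1) ^ ((crossings l e)%:Z + wind l (evec e) (evec f))
           * weight e) *: E f;
  ev_white : forall e f g : edge N,
    internal (tgt e) -> deg (tgt e) = 3%N -> white (tgt e) ->
    src f = tgt e -> src g = tgt e -> f != g ->
    E e = ((-1) ^ ((crossings l e)%:Z + wind l (evec e) (evec f))
           * weight e) *: E f
        + ((-1) ^ ((crossings l e)%:Z + wind l (evec e) (evec g))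
           * weight e) *: E g }.

Definition face D N (F : set (R * R)) :=
  exists2 x, (D `\` drawing N) x & F = connected_component (D `\` drawing N) x.

(* The square is a face F of the drawing; walking its boundary A, B, C, D
   clockwise means having F on the right. *)
Record square D N (vA vB vC vD : vert N) (h1 h2 h3 h4 e1 e2 e3 e4 : edge N) :
    Prop := {
  sq_uniq : uniq [:: vA; vB; vC; vD];
  sq_internal : [/\ internal vA, internal vB, internal vC & internal vD];
  sq_deg : [/\ deg vA = 3%N, deg vB = 3%N, deg vC = 3%N & deg vD = 3%N];
  sq_white : white vA /\ white vC;
  sq_black : ~~ white vB /\ ~~ white vD;
  sq_h1 : src h1 = vA /\ tgt h1 = vB;
  sq_h2 : src h2 = vA /\ tgt h2 = vD;
  sq_h3 : src h3 = vB /\ tgt h3 = vC;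
  sq_h4 : src h4 = vC /\ tgt h4 = vD;
  sq_e1 : tgt e1 = vA;
  sq_e2 : tgt e2 = vB /\ e2 != h1;
  sq_e3 : src e3 = vD;
  sq_e4 : src e4 = vC /\ e4 != h4;
  sq_face : exists F, [/\ face D N F,
    frontier F = drawn h1 `|` drawn h2 `|` drawn h3 `|` drawn h4,
    right_of F (pos vA) (pos vB), right_of F (pos vB) (pos vC) &
    right_of F (pos vC) (pos vD) /\ right_of F (pos vD) (pos vA)] }.

Definition square_move N (vA vB vC vD : vert N) (h1 h2 h3 h4 : edge N) :
    network R n :=
  let a1 := weight h1 in let a2 := weight h2 in
  let a3 := weight h3 in let a4 := weight h4 in
  let a2' := a2 + a1 * a3 * a4 in
  {| vert := vert N;
     edge := edge N;
     src := fun e => if e \in [:: h1; h4] then tgt e else src e;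
     tgt := fun e => if e \in [:: h1; h4] then src e else tgt e;
     bdry := @bdry _ _ N;
     white := fun v =>
       if v \in [:: vA; vB; vC; vD] then ~~ white v else white v;
     pos := @pos _ _ N;
     weight := fun e =>
       if e == h1 then a3 * a4 / a2'
       else if e == h2 then a2'
       else if e == h3 then a2 * a3 / a2'
       else if e == h4 then a1 * a3 / a2'
       else weight e |}.

End Networks.

(* Main.v *)
(** At a trivalent vertex the product of the signs of three windings is governed
    by the cyclic order of the edges ([wind_parity], [wind_swap]).  At C and D
    this order is forced by the square being a face: if the outer edge entered the
    corner of the face, one of the two sectors it cuts off there would be less
    than a half plane, a small triangle in that sector would lie in the face, and
    so the outer edge would lie in the frontier of the face, which consists of the
    four sides.  Moreover the four sides have an even total number of
    intersections with the gauge rays: by convexity of the disk, an edge between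
    internal vertices meets the ray from b exactly when its ends are on opposite
    sides of the line through b.  Given these three sign identities, the
    relations at C and D before and after the move determine the new vectors. *)
Require Import Defs.
From mathcomp Require Import all_boot all_order all_algebra.
From mathcomp Require Import all_classical all_reals.
From mathcomp Require Import topology normedtype convex.
From mathcomp Require Import unstable interval_inference ring lra.
Set Implicit Arguments.
Unset Strict Implicit.
Unset Printing Implicit Defensive.
Import Order.TTheory GRing.Theory Num.Theory.
Import numFieldNormedType.Exports.
Local Open Scope classical_set_scope.
Local Open Scope ring_scope.

(** Turns a degree into an explicit list of the edges at a vertex. *)
Lemma mem_of_card (T : finType) (P : pred T) (s : seq T) :
  uniq s -> {in s, forall x, P x} -> #|P| = size s -> forall x, P x -> x \in s.
Proof.
move=> us sP cP x Px; have e : #|s| = #|P| by rewrite (card_uniqP us).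
have sub : s \subset P by apply/fintype.subsetP.
by have /(_ x) := subset_cardP e sub => ->.
Qed.

(** * Plane geometry *)

Section Orientation.
Context {R : realType}.
Implicit Types (p q r l u v : (R * R)%type) (z : int).

Lemma crossC u v : cross v u = - cross u v.
Proof. by rewrite /cross; ring. Qed.

Lemma crossDr u v w : cross u (v + w) = cross u v + cross u w :> R.
Proof. by rewrite /cross /=; ring. Qed.

Lemma crossZr (c : R) u v : cross u (c *: v) = c * cross u v.
Proof. by rewrite /cross /= /GRing.scale /=; ring. Qed.

Lemma crossNr u v : cross u (- v) = - cross u v.
Proof. by rewrite /cross /=; ring. Qed.

Lemma cross0r u : cross u 0 = 0.
Proof. by rewrite /cross /=; ring. Qed.

Lemma crossrr u : cross u u = 0.
Proof. by rewrite /cross; ring. Qed.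

Lemma orientC u v : orient v u = - orient u v.
Proof. by rewrite /orient crossC sgzN. Qed.

Lemma orientNr u v : orient u (- v) = - orient u v.
Proof. by rewrite /orient crossNr sgzN. Qed.

Lemma orientNl u v : orient (- u) v = - orient u v.
Proof. by rewrite orientC orientNr -orientC. Qed.

Lemma orient_cases u v : [\/ orient u v = -1, orient u v = 0 | orient u v = 1].
Proof.
rewrite /orient; case: (sgzP (cross u v)) => _.
- by apply: Or32.
- by apply: Or33.
- by apply: Or31.
Qed.

(** With a boolean exponent, signs compute as soon as orientations are replaced by their values. *)
Lemma signz z : (-1) ^ z = (-1) ^+ odd `|z|%N :> R.
Proof.
case: z => m; first by rewrite -exprnP signr_odd.
by rewrite NegzE abszN absz_nat signr_odd -exprnN -exprVn invrN1.
Qed.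

Lemma sgz_sum0 (x y z : R) : x + y + z = 0 ->
  0 <= sgz x -> 0 <= sgz y -> 0 <= sgz z -> [&& sgz x == 0, sgz y == 0 & sgz z == 0].
Proof.
rewrite !sgz_ge0 !sgz_eq0 => e x0 y0 z0.
by apply/and3P; split; apply/eqP; lra.
Qed.

(** The Grassmann-Plücker relation: the three products of cross products add up to 0, so they cannot
    all have one weak sign without vanishing. The factor [s] covers both signs at once. *)
Lemma orient_pluecker l p q r (s : int) : s = 1 \/ s = -1 ->
  let x := s * (orient l p * orient q r) in
  let y := s * (orient l q * orient r p) in
  let z := s * (orient l r * orient p q) in
  0 <= x -> 0 <= y -> 0 <= z -> [&& x == 0, y == 0 & z == 0].
Proof.
move=> hs; pose c : R := s%:~R.
have -> : s = sgz c by case: hs => es; rewrite /c es ?rmorphN1 ?sgzN sgz1.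
rewrite /orient -!sgzM; apply: sgz_sum0; rewrite /cross; ring.
Qed.

(** Counterclockwise cyclic order of three distinct directions: the angles between consecutive ones
    add up to a full turn, so at most one is pi or more, and conversely two turns below pi force the
    order. *)
Definition ccw p q r : bool :=
  [|| (orient p q == 1) && (orient q r == 1), (orient q r == 1) && (orient r p == 1)
    | (orient r p == 1) && (orient p q == 1)].

(* Parallel vectors that actually point in opposite directions, which is all that
   two edges leaving a common vertex can do. *)
Definition antipar p q : Prop :=
  orient p q = 0 -> forall x, orient q x = - orient p x.

(** Both sides depend only on the six signs of the cross products of [l], [p], [q], [r]. A finite
    check suffices, since every bad sign pattern violates the Plücker relation or makes parallel
    vectors point the same way. *)
Lemma wind_parity l p q r : orient p l != 0 -> orient q l != 0 ->
  orient r l != 0 -> antipar p q -> antipar q r -> antipar r p -> ccw p q r ->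
  (-1) ^ (wind l (- p) r + wind l (- q) r) =
    (-1) ^ (gamma2 l q + wind l (- p) q + 1) :> R.
Proof.
move=> lp lq lr apq aqr arp.
have P1 := @orient_pluecker l p q r _ (or_introl (erefl 1)).
have P2 := @orient_pluecker l p q r _ (or_intror (erefl (-1))).
have h1 (e : orient p q = 0) := apq e l.
have h2 (e : orient q r = 0) := aqr e l.
have h3 (e : orient r p = 0) := arp e l.
move: lp lq lr P1 P2 h1 h2 h3; rewrite !signz /ccw /gamma2 /wind !orientNl.
rewrite ![orient l _]orientC (orientC p r).
case: (orient_cases p l) => ->; case: (orient_cases q l) => ->;
 case: (orient_cases r l) => -> //;
 case: (orient_cases p q) => ->; case: (orient_cases q r) => ->;
 case: (orient_cases p r) => -> // _ _ _ P1 P2 h1 h2 h3 //= _;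
 by [move: (P1 isT isT isT)|move: (P2 isT isT isT)
    |move: (h1 erefl)|move: (h2 erefl)|move: (h3 erefl)].
Qed.

Lemma cross_neq0l u v : cross u v != 0 -> u != 0.
Proof. by apply: contraNneq => ->; rewrite crossC cross0r oppr0. Qed.

Lemma normsq_gt0 u : u != 0 -> 0 < u.1 * u.1 + u.2 * u.2.
Proof.
move=> u0; rewrite lt_neqAle addr_ge0 -?expr2 ?sqr_ge0 // andbT eq_sym.
apply: contra u0; rewrite paddr_eq0 ?sqr_ge0 // !sqrf_eq0.
by case: u => a b /= /andP[/eqP -> /eqP ->].
Qed.

Lemma cross0_scale p q : p != 0 -> cross p q = 0 -> exists c : R, q = c *: p.
Proof.
move=> /normsq_gt0 n0 /eqP; rewrite subr_eq0 => /eqP cpq.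
(* The coefficient of the orthogonal projection of [q] onto the line of [p]. *)
pose c := (p.1 * q.1 + p.2 * q.2) / (p.1 * p.1 + p.2 * p.2); exists c.
rewrite [LHS]surjective_pairing [RHS]surjective_pairing /=.
by congr pair; apply: (mulIf (lt0r_neq0 n0));
  rewrite [c *: _]/(c * _) mulrAC divfK ?lt0r_neq0 //; ring: cpq.
Qed.

Lemma antiparP p q : p != 0 -> q != 0 ->
  (forall s t : R, 0 < s < 1 -> 0 < t < 1 -> s *: p <> t *: q) -> antipar p q.
Proof.
move=> p0 q0 npq /eqP; rewrite sgz_eq0 => /eqP /(cross0_scale p0)[c e] x.
have c0 : c != 0 by apply: contraNneq q0 => c0; rewrite e c0 scale0r.
have [cp|cn] := ltP 0 c; last first.
  have {}cn : c < 0 by rewrite lt_neqAle c0.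
  by rewrite e /orient crossC crossZr sgzN sgzM (ltr0_sgz cn) mulN1r opprK -sgzN -crossC crossC sgzN.
(* For [q = c *: p] with [c > 0], the vector [q / (2 (1 + c))] lies on both open segments. *)
have d0 : 0 < (2 * (1 + c))^-1 by rewrite invr_gt0; lra.
case: (npq (c * (2 * (1 + c))^-1) (2 * (1 + c))^-1); last by rewrite e scalerA mulrC.
- by rewrite mulr_gt0 //= ltr_pdivrMr; lra.
- by rewrite d0 /= invf_lt1; lra.
Qed.

(* If r were in the sector swept from p counterclockwise to q, then one of the
   sectors from p to r and from r to q would have an angle less than pi. *)
Lemma ccw_of_sectors l p q r : orient p l != 0 ->
  antipar p q -> antipar q r -> antipar r p ->
  ~ (0 < cross p r /\ (cross p q < 0 \/ cross q r < 0)) ->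
  ~ (cross q r < 0 /\ (cross p q < 0 \/ 0 < cross p r)) -> ccw p q r.
Proof.
move=> lp apq aqr arp; rewrite -(sgz_gt0 (cross p r)) -(sgz_lt0 (cross p q)) -(sgz_lt0 (cross q r)) /ccw.
rewrite -[sgz (cross p r)]/(orient p r) -[sgz (cross p q)]/(orient p q).
rewrite -[sgz (cross q r)]/(orient q r).
have h1 (e : orient p q = 0) := apq e l.
have h2 (e : orient q r = 0) := aqr e l.
have h3 (e : orient r p = 0) := arp e l.
have k1 (e : orient p q = 0) := apq e r.
have k2 (e : orient q r = 0) := aqr e p.
have k3 (e : orient r p = 0) := arp e q.
move: lp h1 h2 h3 k1 k2 k3.
rewrite ?(orientC p r) ?(orientC q r) ?(orientC p q).
case: (orient_cases p l) => ->; case: (orient_cases q l) => ->;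
 case: (orient_cases r l) => -> //;
 case: (orient_cases p q) => ->; case: (orient_cases q r) => ->;
 case: (orient_cases p r) => -> // _ h1 h2 h3 k1 k2 k3 n1 n2 //=;
 by [move: (h1 erefl)|move: (h2 erefl)|move: (h3 erefl)
    |move: (k1 erefl)|move: (k2 erefl)|move: (k3 erefl)
    |case: n1; split=> //; by [left|right]|case: n2; split=> //; by [left|right]].
Qed.

(** * Segments, convexity and the corners of a face *)

Lemma continuous_line (x v : (R * R)%type) : continuous (fun t : R => x + t *: v).
Proof.
move=> t; apply: cvgD; first exact: cvg_cst.
by apply: cvgZr_tmp; exact: cvg_id.
Qed.

Lemma segment_image (x y : R * R) :
  segment x y = (fun t => x + t *: (y - x)) @` `[0, 1]%classic.
Proof. by rewrite set_itvcc. Qed.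

Lemma closed_segment (x y : R * R) : closed (segment x y).
Proof.
apply: compact_closed; first exact: norm_hausdorff.
rewrite segment_image; apply: continuous_compact; last exact: segment_compact.
exact: continuous_subspaceT (@continuous_line _ _).
Qed.

Lemma connected_segment (x y : R * R) : connected (segment x y).
Proof.
rewrite segment_image; apply: connected_continuous_connected.
  exact: segment_connected.
exact: continuous_subspaceT (@continuous_line _ _).
Qed.

Lemma convex_setP (D : set (R * R)) (x y : R * R) (t : R) :
  convex_set (D : set (convex_lmodType (R * R)%type)) ->
  D x -> D y -> 0 <= t <= 1 -> D (x + t *: (y - x)).
Proof.
move=> cD Dx Dy /andP[t0 t1].
have := cD y x (Itv01 t0 t1); rewrite !in_setE => /(_ Dy Dx).
congr (D _); rewrite /conv /= /onem scalerBr scalerBl scale1r.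
by rewrite addrC addrAC addrA.
Qed.

Lemma nbhs_shift (x : R * R) (P : set (R * R)) : nbhs x P <->
  exists2 e : R, 0 < e & forall v, `|v| < e -> P (x + v).
Proof.
split.
  rewrite -nbhs_nbhs_norm => -[e /= e0 xP]; exists e => // v ve.
  by apply: xP; rewrite /ball_ /= opprD addNKr normrN.
move=> [e e0 xP]; rewrite -nbhs_nbhs_norm; exists e => // y /=.
by rewrite /ball_ /= distrC => /xP; rewrite addrC subrK.
Qed.

(** A small translation applied to both end points translates their convex combination by the same
    vector. *)
Lemma interior_convex (D : set (R * R)) (x y : R * R) (t : R) :
  convex_set (D : set (convex_lmodType (R * R)%type)) ->
  D° x -> D° y -> 0 <= t <= 1 -> D° (x + t *: (y - x)).
Proof.
move=> cD /nbhs_shift[e e0 Dx] /nbhs_shift[e' e'0 Dy] t01.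
apply/nbhs_shift; exists (Num.min e e'); first by rewrite lt_min e0.
move=> v; rewrite lt_min => /andP[/Dx xv /Dy yv].
have := convex_setP cD xv yv t01; congr (D _).
by rewrite opprD addrACA subrr addr0 addrAC.
Qed.

Lemma cramer p r v : cross p r != 0 ->
  v = (cross v r / cross p r) *: p + (cross p v / cross p r) *: r.
Proof.
move=> c0; rewrite [LHS]surjective_pairing [RHS]surjective_pairing /=.
by congr pair; rewrite -![_ *: _]/(_ * _); rewrite /cross in c0 *; field.
Qed.

Lemma norm_comb (a b : R) (p r : R * R) : 0 <= a -> 0 <= b ->
  `|a *: p + b *: r| <= (a + b) * (`|p| + `|r|).
Proof.
move=> a0 b0; apply: (le_trans (ler_normD _ _)); rewrite !normrZ !ger0_norm //.
have := normr_ge0 p; have := normr_ge0 r; nra.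
Qed.

Lemma conv_gt0 (x y t : R) : 0 < x -> 0 < y -> 0 <= t -> t <= 1 ->
  0 < x + t * (y - x).
Proof.
move=> x0 y0 t0 t1; have -> : x + t * (y - x) = (1 - t) * x + t * y by ring.
have [t_lt1|t_ge1] := ltP t 1; last by nra.
have := mulr_ge0 t0 (ltW y0); have : 0 < (1 - t) * x by rewrite mulr_gt0 ?subr_gt0.
by move=> *; rewrite ltr_pwDl.
Qed.

(* The sector is the open convex cone spanned by p and r; m points from the ray of
   p into the side of r, and q is not inside the cone. *)
Lemma sector_in_closure (D S : set (R * R)) (x0 X p q r m : R * R) :
  let F := connected_component (D `\` S) x0 in
  (\forall y \near X, D y /\ (S y ->
     [\/ segment X (X + p) y, segment X (X + q) y | segment X (X + r) y])) ->
  cross p r != 0 -> 0 < cross p m * cross p r ->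
  ~ (0 < cross p q * cross p r /\ 0 < cross q r * cross p r) ->
  (forall t, 0 < t < 1 -> \forall eps \near 0^'+, F (X + t *: p + eps *: m)) ->
  exists2 s, 0 < s < 1 & closure F (X + s *: r).
Proof.
move=> F /nbhs_shift[e e0 nX] c0 mpos nq hF.
have K0 : 0 < `|p| + `|r| + 1 by rewrite ltr_wpDl ?addr_ge0.
(* The triangle of the points [X + a p + b r] with [a, b > 0] and [a + b < d] stays in the
   neighbourhood of [X] where the drawing is known. *)
have [d [d0 d1 dK]] : exists d : R, [/\ 0 < d, d <= 1 & d * (`|p| + `|r| + 1) <= e].
  exists (Num.min 1 (e / (`|p| + `|r| + 1))); split.
  - by rewrite lt_min ltr01 divr_gt0.
  - by rewrite ge_min lexx.
  - by rewrite -ler_pdivlMr // ge_min lexx orbT.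
have tri a b : 0 < a -> 0 < b -> a + b < d -> (D `\` S) (X + (a *: p + b *: r)).
  move=> a0 b0 abd; case: (nX (a *: p + b *: r)).
    apply: le_lt_trans (norm_comb _ _ (ltW a0) (ltW b0)) _.
    by have := normr_ge0 p; have := normr_ge0 r; nra.
  move=> Dy Sy; split=> // /Sy[] [t /= /andP[t0 t1]];
    rewrite addrAC subrr add0r => /addrI et.
  - have := congr1 (cross p) et; rewrite !(crossDr, crossZr) crossrr !mulr0 add0r.
    by move/esym/eqP; rewrite mulf_eq0 (negPf c0) gt_eqF.
  (* Here [t q = a p + b r] with [t > 0], which would put [q] inside the cone. *)
  - have := congr1 (cross p) et; have := congr1 (cross r) et.
    rewrite !(crossDr, crossZr) !crossrr !mulr0 add0r addr0.
    rewrite ![cross r _]crossC => e1 e2.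
    have t0' : t != 0.
      apply: contraTneq b0 => tz; move: e2; rewrite tz mul0r => /esym/eqP.
      by rewrite mulf_eq0 (negPf c0) orbF => /eqP ->; rewrite ltxx.
    have tp : 0 < t by rewrite lt_neqAle eq_sym t0'.
    have cc : 0 < cross p r * cross p r by rewrite -expr2 exprn_even_gt0.
    by apply: nq; split; rewrite -(pmulr_rgt0 _ tp); nra.
  - have := congr1 (cross r) et; rewrite !(crossDr, crossZr) crossrr !mulr0 addr0.
    by move/esym/eqP; rewrite crossC mulf_eq0 oppr_eq0 (negPf c0) gt_eqF.
(* The triangle is convex and avoids [S], so one point of it in the component [F] brings in all the
   others. *)
have conn a b a' b' : 0 < a -> 0 < b -> a + b < d -> 0 < a' -> 0 < b' ->
    a' + b' < d -> F (X + (a *: p + b *: r)) -> F (X + (a' *: p + b' *: r)).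
  move=> a0 b0 ab a'0 b'0 ab' Fy; apply: connected_component_trans Fy _.
  apply: (connected_component_max (B := segment (X + (a *: p + b *: r))
                                            (X + (a' *: p + b' *: r)))).
  - by exists 0; rewrite /= ?lexx ?ler01 // scale0r addr0.
  - move=> _ [t /= /andP[t0 t1] <-].
    have -> : X + (a *: p + b *: r) +
        t *: (X + (a' *: p + b' *: r) - (X + (a *: p + b *: r))) =
        X + ((a + t * (a' - a)) *: p + (b + t * (b' - b)) *: r).
      rewrite opprD addrACA subrr add0r -addrA; congr (_ + _).
      rewrite opprD addrACA scalerDr -!scalerBl !scalerA addrACA -!scalerDl.
      by [].
    apply: tri; [exact: conv_gt0 | exact: conv_gt0 | rewrite -subr_gt0].
    have -> : d - (a + t * (a' - a) + (b + t * (b' - b))) =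
      (d - (a + b)) + t * ((d - (a' + b')) - (d - (a + b))) by ring.
    by apply: conv_gt0; rewrite ?subr_gt0.
  - exact: connected_segment.
  - by exists 1; rewrite /= ?lexx ?ler01 // scale1r addrC subrK.
(* The coordinates of [m] in the basis [p], [r]; positivity of [be] says that [m] points to the side
   of [r]. *)
pose al := cross m r / cross p r; pose be := cross p m / cross p r.
have be0 : 0 < be.
  have c2 : 0 < cross p r * cross p r by rewrite -expr2 exprn_even_gt0.
  have -> : be = (cross p m * cross p r) / (cross p r * cross p r) by rewrite /be; field.
  exact: divr_gt0.
have h2 : 0 < d / 2 by lra.
(* The bound on [eps] keeps the point of [F] next to the middle of [d p] inside the triangle. *)
have [eps [eps0 epsd Feps]] : exists eps, [/\ 0 < eps,
    eps * (`|al| + be + 1) < d / 2 & F (X + (d / 2) *: p + eps *: m)].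
  have hK : 0 < `|al| + be + 1 by have := normr_ge0 al; lra.
  have P0 : 0 < (d / 2) / (`|al| + be + 1) by rewrite divr_gt0.
  have hd : 0 < d / 2 < 1 by lra.
  apply: (@filter_ex _ (0 : R)^'+); near=> eps; split.
  - by near: eps; exact: nbhs_right_gt.
  - by rewrite -ltr_pdivlMr //; near: eps; exact: nbhs_right_lt.
  - by near: eps; exact: hF.
have start : F (X + ((d / 2 + eps * al) *: p + (eps * be) *: r)).
  move: Feps; rewrite {1}(cramer m c0) -/al -/be scalerDr !scalerA.
  by rewrite !addrA scalerDl !addrA.
(* The points [X + a p + (d / 2) r] with [0 < a <= d / 4] lie in the triangle and tend to
   [X + (d / 2) r] as [a] tends to 0. *)
exists (d / 2); first by lra.
move=> B /nbhs_shift[e' e'0 He'].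
pose a := Num.min (d / 4) (e' / (`|p| + 1)).
have p1 : 0 < `|p| + 1 by have := normr_ge0 p; lra.
have a0 : 0 < a by rewrite lt_min !divr_gt0.
have ad : a <= d / 4 by rewrite ge_min lexx.
have ae : a * (`|p| + 1) <= e' by rewrite -ler_pdivlMr // ge_min lexx orbT.
exists (X + (a *: p + (d / 2) *: r)); split.
  have := ler_norm al; have := ler_norm (- al); rewrite normrN => n1 n2.
  apply: conn start; try lra; nra.
rewrite addrCA addrC; apply: He'; rewrite normrZ gtr0_norm //.
by apply: lt_le_trans ae; nra.
Unshelve. all: by end_near.
Qed.

(** Otherwise [sector_in_closure], applied from the side of [p] or from that of [q], puts an inner
    point of the edge along [r] into the closure of [F]. This point is in [S], hence not in [F],
    hence in the frontier, which is excluded. *)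
Lemma ccw_corner (D S : set (R * R)) (x0 X p q r l : R * R) :
  let F := connected_component (D `\` S) x0 in
  (\forall y \near X, D y /\ (S y ->
     [\/ segment X (X + p) y, segment X (X + q) y | segment X (X + r) y])) ->
  orient p l != 0 -> antipar p q -> antipar q r -> antipar r p ->
  right_of F (X + p) X -> right_of F X (X + q) ->
  (forall s, 0 < s < 1 -> S (X + s *: r) /\ ~ frontier F (X + s *: r)) ->
  ccw p q r.
Proof.
move=> F nX lp apq aqr arp Rp Rq rS.
have closF s : 0 < s < 1 -> ~ closure F (X + s *: r).
  move=> s01 clF; have [Sr nfr] := rS s s01; apply: nfr; split=> //.
  by move=> /interior_subset /connected_component_sub[].
apply: (ccw_of_sectors lp) => //.
(* Walking along [- p] towards [X], the right-hand normal is [p] turned counterclockwise. *)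
- move=> [cpr h]; pose m : R * R := (- p.2, p.1).
  have cpm : 0 < cross p m.
    have p0 : p != 0 by apply: (@cross_neq0l _ r); rewrite gt_eqF.
    have -> : cross p m = p.1 * p.1 + p.2 * p.2 by rewrite /cross /m /=; ring.
    exact: normsq_gt0.
  case: (@sector_in_closure D S x0 X p q r m nX).
  + by rewrite gt_eqF.
  + exact: mulr_gt0.
  + by rewrite !pmulr_lgt0 // => -[]; lra.
  (* The side is walked towards [X], so distance from [X] reverses the parameter. *)
  + move=> t t01; have t01' : 0 < 1 - t < 1 by lra.
    move: (Rp _ t01'); apply: filterS => eps.
    congr F; rewrite opprD addrA subrr add0r; congr (_ + _ *: _).
      by rewrite scalerN scalerBl scale1r opprB addrACA subrr addr0.
    by rewrite /m /= opprK.
  + by move=> s s01 /(closF _ s01).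
- move=> [cqr h]; pose m : R * R := (q.2, - q.1).
  have cqm : cross q m < 0.
    have q0 : q != 0 by apply: (@cross_neq0l _ r); rewrite lt_eqF.
    have -> : cross q m = - (q.1 * q.1 + q.2 * q.2) by rewrite /cross /m /=; ring.
    by rewrite oppr_lt0 normsq_gt0.
  have nX' : \forall y \near X, D y /\ (S y ->
     [\/ segment X (X + q) y, segment X (X + p) y | segment X (X + r) y]).
    apply: filterS nX => y [Dy Sy]; split=> // /Sy [] sy.
    - exact: Or32.
    - exact: Or31.
    - exact: Or33.
  case: (@sector_in_closure D S x0 X q p r m nX').
  + by rewrite lt_eqF.
  + by rewrite nmulr_rgt0.
  + by rewrite !nmulr_lgt0 // (crossC p q) oppr_lt0 => -[]; lra.
  + have e : X + q - X = q by rewrite addrAC subrr add0r.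
    by move=> t t01; move: (Rq _ t01); rewrite e.
  + by move=> s s01 /(closF _ s01).
Qed.

(** Exchanges the roles of the two sides at a corner. It is needed at D, where [wind_parity] yields
    the winding from [h4] to [- h2] but the formulas use the one from [h2] to [- h4]. *)
Lemma wind_swap (l p q : R * R) : orient p l != 0 -> orient q l != 0 -> antipar p q ->
  (-1) ^ (gamma2 l q + wind l (- p) q + 1) =
  (-1) ^ (gamma2 l p + wind l (- q) p) :> R.
Proof.
move=> lp lq apq; have := apq ^~ l; move: lp lq.
rewrite !signz /gamma2 /wind !orientNl ![orient l _]orientC (orientC p q).
by case: (orient_cases p l) => ->; case: (orient_cases q l) => ->;
  case: (orient_cases p q) => -> // _ _ h //=; move: (h erefl).
Qed.

(** * Sign calculus and linear elimination *)

Lemma sign_gamma2N (l u : R * R) : orient u l != 0 ->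
  (-1) ^ gamma2 l (- u) = - (-1) ^ gamma2 l u :> R.
Proof.
by rewrite !signz /gamma2 !orientNl; case: (orient_cases u l) => -> //= _;
  rewrite /= ?expr0 ?expr1 ?opprK.
Qed.

Lemma signD (x y : int) : (-1) ^ (x + y) = (-1) ^ x * (-1) ^ y :> R.
Proof. by rewrite expfzDr // oppr_eq0 oner_eq0. Qed.

Lemma sign_sq (x : int) : (-1) ^ x * (-1) ^ x = 1 :> R.
Proof. by rewrite signz -expr2 sqrr_sign. Qed.

(** The linear algebra of the move. The [xi] are the signs of the crossings of [hi], and [g] is that
    of [gamma2] at [h4]; [u], [a], [b], [c], [d], [f] are the signs of the windings (h3,h4),
    (h3,e4), (-h4,e4), (h2,e3), (h4,e3), (h2,-h4). *)
Lemma square_elimination (V : lmodType R) (F3 F4 F2' F3' F4' E3 E4 : V)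
    (a1 a2 a3 a4 x1 x2 x3 x4 g u a b c d f : R) :
  0 < a1 -> 0 < a2 -> 0 < a3 -> 0 < a4 ->
  x1 * x1 = 1 -> x2 * x2 = 1 -> x3 * x3 = 1 -> x4 * x4 = 1 ->
  g * g = 1 -> u * u = 1 -> a * a = 1 -> c * c = 1 -> f * f = 1 ->
  a * b = - (g * u) -> c * d = - (g * f) -> x1 * x2 * x3 * x4 = 1 ->
  let a2' := a2 + a1 * a3 * a4 in
  F3 = (x3 * u * a3) *: F4 + (x3 * a * a3) *: E4 ->
  F4 = (x4 * d * a4) *: E3 ->
  F2' = (x2 * c * a2') *: E3 + (x2 * f * a2') *: F4' ->
  F3' = (x3 * a * (a2 * a3 / a2')) *: E4 ->
  F4' = (x4 * b * (a1 * a3 / a2')) *: E4 ->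
  [/\ F4' = (a1 * a3 / a2' / a3 * (x3 * x4 * g * u * -1)) *: F3
            + (a1 * a3 / a2' * (x4 * g)) *: F4,
      F2' = (a1 * (x1 * g * f * u * -1)) *: F3
            + (a2 / a4 * (-1 * x2 * x4 * g * f)) *: F4 &
      F3' = (x3 * x4 * g * u * -1 * (a2 / a1)) *: F4'].
Proof.
move=> a1p a2p a3p a4p s1 s2 s3 s4 sg su sa sc sf eb ed ex a2' eF3 eF4 eF2' eF3' eF4'.
have a2p' : 0 < a2' by rewrite addr_gt0 ?mulr_gt0.
have [n1 n2 n3 n4 n2'] : [/\ a1 != 0, a2 != 0, a3 != 0, a4 != 0 & a2' != 0].
  by rewrite !lt0r_neq0.
have {}eb : b = - (a * g * u) by rewrite -[b]mul1r -sa -mulrA eb; ring.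
have {}ed : d = - (c * g * f) by rewrite -[d]mul1r -sc -mulrA ed; ring.
have {}ex : x1 = x2 * x3 * x4.
  have -> : x1 = x1 * x2 * x3 * x4 * (x2 * x3 * x4) by ring: s2 s3 s4.
  by rewrite ex mul1r.
have e2 : a2' = a2 + a1 * a3 * a4 by [].
clearbody a2'.
have eF4'' : F4' = (a1 * a3 / a2' / a3 * (x3 * x4 * g * u * -1)) *: F3
            + (a1 * a3 / a2' * (x4 * g)) *: F4.
  rewrite eF3 scalerDr !scalerA addrAC -scalerDl eF4' eb.
  (* The part of [F3] along [F4] cancels the explicit [F4] term, so only [E4] remains. *)
  rewrite [X in X *: F4 + _](_ : _ = 0) ?scale0r ?add0r; last first.
    have -> : a1 * a3 / a2' / a3 * (x3 * x4 * g * u * -1) * (x3 * u * a3) =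
      - ((x3 * x3) * (u * u) * (a1 * a3 / a2' * (x4 * g))) by field; rewrite n2' n3.
    by rewrite s3 su; ring.
  congr (_ *: _).
  have -> : a1 * a3 / a2' / a3 * (x3 * x4 * g * u * -1) * (x3 * a * a3) =
    (x3 * x3) * (x4 * - (a * g * u) * (a1 * a3 / a2')) by field; rewrite n2' n3.
  by rewrite s3 mul1r.
split=> //.
  rewrite eF2' eF4'' eF4 scalerDr !scalerA addrCA -scalerDl; congr (_ *: _ + _ *: _).
    rewrite ex.
    have -> : x2 * f * a2' * (a1 * a3 / a2' / a3 * (x3 * x4 * g * u * -1)) =
      a1 * (x2 * x3 * x4 * g * f * u * -1) by field; rewrite n2' n3.
    by [].
  (* The coefficients of [E3] agree because [a2' - a1 * a3 * a4 = a2]. *)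
  rewrite ed.
  have -> : x2 * f * a2' * (a1 * a3 / a2' * (x4 * g)) * (x4 * - (c * g * f) * a4) =
    - ((x4 * x4) * (g * g) * (f * f) * (x2 * c * (a1 * a3 * a4))).
    by field; rewrite n2'.
  have -> : a2 / a4 * (-1 * x2 * x4 * g * f) * (x4 * - (c * g * f) * a4) =
    (x4 * x4) * (g * g) * (f * f) * (x2 * c * a2) by field; rewrite n4.
  by rewrite s4 sg sf e2; ring.
rewrite eF3' eF4' scalerA eb; congr (_ *: _).
have -> : x3 * x4 * g * u * -1 * (a2 / a1) * (x4 * - (a * g * u) * (a1 * a3 / a2')) =
  (x4 * x4) * (g * g) * (u * u) * (x3 * a * (a2 * a3 / a2')).
  by field; rewrite n2' n1.
by rewrite s4 sg su; ring.
Qed.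

Lemma sign_crossings (a b c d : nat) : ~~ odd (a + b + c + d) ->
  (-1) ^ a%:Z * (-1) ^ b%:Z * (-1) ^ c%:Z * (-1) ^ d%:Z = 1 :> R.
Proof.
by move=> o; rewrite -!exprnP -!exprD -signr_odd (negPf o).
Qed.

End Orientation.

(** * Plabic networks *)

Section Network.
Context {R : realType} {n k : nat} {D : set (R * R)} {N : network R n} {l : (R * R)%type}.
Hypotheses (plN : plabic_network k D N) (gl : gauge_direction D N l) (l_neq0 : l != 0).
Implicit Types (v w : vert N) (e f g : edge N) (j : 'I_n).

(** * Edges at an internal vertex *)

Definition incident v e := (src e == v) || (tgt e == v).

(** The cyclic order at a vertex ignores orientations, so every edge is pointed away from [v]. *)
Definition outward v e : (R * R)%type := if src e == v then evec e else - evec e.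

Lemma segmentC (x y : R * R) : segment x y = segment y x.
Proof.
suff sub (a b : R * R) : segment a b `<=` segment b a by apply/seteqP; split; apply: sub.
move=> _ [t /= t01 <-]; exists (1 - t); first by rewrite /=; lra.
by rewrite scalerBl scale1r -scalerN opprB addrA (addrCA b) subrr addr0.
Qed.

Lemma drawn_outward v e : incident v e ->
  drawn e = segment (pos v) (pos v + outward v e).
Proof.
rewrite /incident /outward /drawn /evec; case: eqP => [<- _|_ /= /eqP <-].
  by rewrite addrC subrK.
by rewrite opprB addrC subrK segmentC.
Qed.

Lemma pos_end v e w : incident v e -> w \in [:: src e; tgt e] ->
  pos w = pos v \/ pos w = pos v + outward v e.
Proof.
rewrite /incident /outward /evec !inE; case: eqP => [<- _|_ /= /eqP <-] /orP[]/eqP -> ;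
  [by left | by right; rewrite addrC subrK | by right; rewrite opprB addrC subrK | by left].
Qed.

Lemma outward_neq0 v e : outward v e != 0.
Proof.
have ee : evec e != 0.
  rewrite subr_eq0; apply: contra (pn_noloop plN e) => /eqP /(pn_pos_inj plN) ->.
  exact: eqxx.
by rewrite /outward; case: ifP; rewrite ?oppr_eq0.
Qed.

Lemma drawn_outward_point v e (s : R) : incident v e -> 0 < s < 1 ->
  drawn e (pos v + s *: outward v e).
Proof.
move=> ve s01; rewrite (drawn_outward ve); exists s; first by rewrite /=; lra.
by rewrite addrAC subrr add0r.
Qed.

(** By planarity a common point is an end of [e], which corresponds to [s = 0] or [s = 1]. *)
Lemma edges_overlap v e f (s : R) : incident v e -> f != e -> 0 < s < 1 ->
  ~ drawn f (pos v + s *: outward v e).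
Proof.
move=> ve fe s01 fx.
have [w [xw _ we]] := pn_planar plN fe fx (drawn_outward_point ve s01).
have o0 := outward_neq0 v e.
move: xw; case: (pos_end ve we) => -> /eqP.
  by rewrite -subr_eq0 addrAC subrr add0r scaler_eq0 (negPf o0) gt_eqF //; lra.
rewrite -subr_eq0 opprD addrACA subrr add0r -{2}[outward v e]scale1r -scalerBl.
by rewrite scaler_eq0 (negPf o0) subr_eq0 lt_eqF //; lra.
Qed.

Lemma outward_antipar v e f : incident v e -> incident v f -> e != f ->
  antipar (outward v e) (outward v f).
Proof.
move=> ve vf ef; apply: antiparP; rewrite ?outward_neq0 // => s t s01 t01 est.
by have := edges_overlap vf ef t01; rewrite -est; case; apply: drawn_outward_point.
Qed.

(** There are finitely many edges, all closed. One that does not end at [v] misses [pos v], by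
    planarity against the given incident edge [e]. *)
Lemma near_vertex v e : internal v -> incident v e ->
  \forall y \near pos v, D y /\
    (drawing N y -> exists2 f, incident v f & drawn f y).
Proof.
move=> iv ve; apply: filterI; first exact: (pn_internal_pos plN iv).
have : \forall y \near pos v, forall f, ~~ incident v f -> ~ drawn f y.
  apply: (@filter_forall _ _ (fun f y => ~~ incident v f -> ~ drawn f y) (nbhs (pos v)) _) => f.
  have [vf|vf] := boolP (incident v f).
    by apply: nearW.
  suff : \forall y \near pos v, ~ drawn f y by apply: filterS.
  apply: open_nbhs_nbhs; split.
    by rewrite openC; exact: closed_segment.
  move=> fv.
  have fe : f != e by apply: contraNneq vf => ->.
  have ev : drawn e (pos v).
    rewrite (drawn_outward ve); exists 0; first by rewrite /= lexx ler01.
    by rewrite scale0r addr0.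
  have [w [/(pn_pos_inj plN) <- + _]] := pn_planar plN fe fv ev.
  by rewrite !inE ![v == _]eq_sym => wf; move: vf; rewrite /incident wf.
apply: filterS => y yf [f _ fy]; exists f => //.
by apply: contrapT => /negP /yf.
Qed.

Lemma ccw_face_corner v f g e F : internal v ->
  incident v f -> incident v g -> incident v e -> uniq [:: f; g; e] ->
  (forall h, incident v h -> h \in [:: f; g; e]) ->
  orient (outward v f) l != 0 -> face D N F ->
  (forall x, frontier F x -> exists2 h, h != e & drawn h x) ->
  right_of F (pos v + outward v f) (pos v) ->
  right_of F (pos v) (pos v + outward v g) ->
  ccw (outward v f) (outward v g) (outward v e).
Proof.
move=> iv vf vg ve /= /and3P[]; rewrite !inE negb_or => /andP[fg fe] ge _ hv fl.
move=> [x0 _ ->] frF Rf Rg.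
apply: (ccw_corner _ fl _ _ _ Rf Rg).
- apply: filterS (near_vertex iv ve) => y [Dy Sy]; split=> // /Sy[h vh hy].
  by move: hy; have := hv _ vh; rewrite !inE => /or3P[] /eqP ->; rewrite (@drawn_outward v) //;
    [exact: Or31 | exact: Or32 | exact: Or33].
- exact: outward_antipar.
- exact: outward_antipar.
- by apply: outward_antipar; rewrite // eq_sym.
- move=> s s01; split; first by exists e => //; exact: drawn_outward_point.
  by move=> /frF[h he]; exact: edges_overlap.
Qed.

(** * Gauge rays and crossing parities *)

Lemma bdry_frontier j : frontier D (pos (bdry N j)).
Proof.
have [a [b [ab _ [t [t01 _ tp]]]]] := pn_bdry_pos plN.
by apply: ab; exists (t j); [exact: t01 | rewrite tp].
Qed.

(** The ray enters the interior at small positive parameters. An interior point at a parameter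
    [t <= 0] would place the boundary vertex between two interior points, hence in the interior. *)
Lemma ray_param_gt0 j (t : R) : D° (pos (bdry N j) + t *: l) -> 0 < t.
Proof.
move=> Dt; rewrite ltNge; apply/negP => t0.
have [eps [eps0 De]] : exists eps, 0 < eps /\ D° (pos (bdry N j) + eps *: l).
  apply: (@filter_ex _ (0 : R)^'+); near=> eps; split.
    by near: eps; exact: nbhs_right_gt.
  by near: eps; exact: (gd_inside gl j).
have [_ _ cD] := pn_disk plN.
have s01 : 0 <= - t / (eps - t) <= 1.
  have et : 0 < eps - t by lra.
  by rewrite divr_ge0 ?ler_pdivrMr //=; lra.
have := interior_convex cD Dt De s01.
rewrite opprD addrACA subrr add0r -scalerBl scalerA -addrA -scalerDl divfK; last by lra.
by rewrite subrr scale0r addr0; case: (bdry_frontier j).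
Unshelve. all: by end_near.
Qed.

(** The gauge condition excludes [v] from the ray, and [ray_param_gt0] excludes it from the opposite
    half of the line. *)
Lemma cross_ray_neq0 j v : internal v -> cross l (pos v - pos (bdry N j)) != 0.
Proof.
move=> iv; apply/eqP => /(cross0_scale l_neq0)[c /eqP].
rewrite subr_eq addrC => /eqP e.
have c0 : 0 < c by apply: (@ray_param_gt0 j); rewrite -e; exact: pn_internal_pos plN _ iv.
by apply: (gd_vertex gl (j := j) iv (ltW c0)); rewrite e.
Qed.

(** For an edge with a boundary end, being parallel to [l] would put its internal end on the line of
    the gauge ray. *)
Lemma evec_transverse v e : internal v -> incident v e -> orient (evec e) l != 0.
Proof.
have bnd j (u : vert N) : internal u -> orient (pos u - pos (bdry N j)) l != 0.
  by move=> iu; rewrite orientC oppr_eq0 sgz_eq0; exact: cross_ray_neq0.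
have bd (u : vert N) : ~~ internal u -> exists j, u = bdry N j.
  by rewrite negbK => /codomP.
have [is_|/bd[j js]] := boolP (internal (src e)).
  have [it_|/bd[j jt]] := boolP (internal (tgt e)); first by move=> *; exact: gd_parallel gl _ _ _.
  by move=> _ _; rewrite /evec jt -oppr_eq0 -orientNl opprB bnd.
move=> iv /orP[] /eqP e_v; last by rewrite /evec js e_v bnd.
by move: iv; rewrite -e_v js /internal inE codom_f.
Qed.

Lemma outward_transverse v e : internal v -> incident v e -> orient (outward v e) l != 0.
Proof.
by move=> iv ve; rewrite /outward; case: ifP => _; rewrite ?orientNl ?oppr_eq0 (evec_transverse iv ve).
Qed.

Definition left_of_ray j v := 0 < cross l (pos v - pos (bdry N j)).

(** The side of the line is the sign of an affine function along the edge. Where it vanishes the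
    edge is interior to the disk, so the point lies on the ray itself and not on its backward
    extension. *)
Lemma ray_crosses j e : internal (src e) -> internal (tgt e) ->
  `[< exists2 t : R, 0 < t & drawn e (pos (bdry N j) + t *: l) >] =
  left_of_ray j (src e) (+) left_of_ray j (tgt e).
Proof.
move=> is_ it_; rewrite /left_of_ray.
set b := pos (bdry N j).
have cs := cross_ray_neq0 j is_; have ct := cross_ray_neq0 j it_.
rewrite -/b in cs ct.
have cl (s : R) : cross l (pos (src e) + s *: (pos (tgt e) - pos (src e)) - b) =
  cross l (pos (src e) - b) + s * (cross l (pos (tgt e) - b) - cross l (pos (src e) - b)).
  by rewrite /cross /= -![_ *: _]/(_ * _); ring.
set x := cross l (pos (src e) - b) in cs cl *.
set y := cross l (pos (tgt e) - b) in ct cl *.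
apply/asboolP/idP.
  move=> [t t0 [s /= /andP[s0 s1] es]].
  have := cl s; rewrite es addrAC subrr add0r crossZr crossrr mulr0.
  case: (ltgtP x 0) cs => // hx _; case: (ltgtP y 0) ct => // hy _ //=; nra.
move=> xy.
have yx : y - x != 0.
  by rewrite subr_eq0; apply: contraTneq xy => ->; rewrite addbb.
(* The zero of the affine function with values [x] and [y] at the ends. *)
pose s := - x / (y - x).
have s01 : 0 <= s <= 1.
  move: xy; rewrite /s; case: (ltgtP x 0) cs => // hx _; case: (ltgtP y 0) ct => // hy _ //= _.
    by rewrite divr_ge0 ?ler_pdivrMr //=; lra.
  have -> : - x / (y - x) = x / (x - y) by field; lra.
  by rewrite divr_ge0 ?ler_pdivrMr //=; lra.
have /(cross0_scale l_neq0)[t /eqP] : cross l (pos (src e) + s *: (pos (tgt e) - pos (src e)) - b) = 0.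
  by rewrite cl /s divfK // subrr.
rewrite subr_eq [t *: l + b]addrC => /eqP et; exists t; last by rewrite -et; exists s.
apply: (@ray_param_gt0 j); rewrite -/b -et; apply: interior_convex => //.
- by case: (pn_disk plN).
- exact: pn_internal_pos plN _ is_.
- exact: pn_internal_pos plN _ it_.
Qed.

(** Writes the parity as a sum of one contribution per end of the edge, so that it cancels around
    closed walks. *)
Lemma odd_crossings e : internal (src e) -> internal (tgt e) ->
  odd (crossings l e) = \big[addb/false]_j
    (source N j && left_of_ray j (src e) (+) source N j && left_of_ray j (tgt e)).
Proof.
move=> is_ it_; rewrite /crossings -sum1_card big_mkcond /=.
rewrite (big_morph odd oddD (erefl : odd 0 = false)); apply: eq_bigr => j _.
by rewrite inE ray_crosses //; case: (source N j) => //=; case: (_ (+) _).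
Qed.

End Network.

(** * The square move *)

(** In this form reversing an edge only permutes two summands. *)
Lemma deg_sum (R : realType) n (N : network R n) (v : vert N) :
  deg v = (\sum_(e : edge N) ((tgt e == v) + (src e == v)))%N.
Proof.
rewrite /deg /indeg /outdeg -!sum1_card (big_mkcond (fun e => e \in _)).
by rewrite [X in (_ + X)%N]big_mkcond -big_split; apply: eq_bigr => e _ /=; rewrite !inE; do 2 case: eqP.
Qed.

Section SquareMove.
Context {R : realType} {n : nat} {N : network R n} (vA vB vC vD : vert N)
  (h1 h2 h3 h4 : edge N).
Let N' := square_move vA vB vC vD h1 h2 h3 h4.

Lemma deg_square_move (v : vert N) : deg (N := N') v = deg v.
Proof.
by rewrite !deg_sum; apply: eq_bigr => e _ /=; case: ifP => // _; rewrite addnC.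
Qed.

Lemma evec_square_move (e : edge N) :
  evec (N := N') e = if e \in [:: h1; h4] then - evec e else evec e.
Proof. by rewrite /evec /=; case: ifP; rewrite ?opprB. Qed.

Lemma drawn_square_move (e : edge N) : drawn (N := N') e = drawn e.
Proof. by rewrite /drawn /=; case: ifP => // _; rewrite segmentC. Qed.

(** Reversal keeps the drawn segments, and it keeps the boundary sources because the reversed edges
    end at internal vertices. *)
Lemma crossings_square_move (l : R * R) (e : edge N) :
  {in [:: h1; h4], forall h, internal (src h) /\ internal (tgt h)} ->
  crossings (N := N') l e = crossings l e.
Proof.
move=> hi; apply: eq_card => j; rewrite !inE drawn_square_move; congr (_ && _).
rewrite /source /outdeg; congr (_ == _); apply: eq_card => h; rewrite !inE /=.
case: ifP => // /hi[hs ht].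
have nb v : internal v -> (v == bdry N j) = false.
  by move=> iv; apply: contraNF iv => /eqP ->; exact: codom_f.
by rewrite !nb.
Qed.

End SquareMove.

Lemma even_square_crossings (R : realType) n k D (N : network R n) l
    (vA vB vC vD : vert N) h1 h2 h3 h4 :
  plabic_network k D N -> gauge_direction D N l -> l != 0 ->
  [/\ internal vA, internal vB, internal vC & internal vD] ->
  src h1 = vA /\ tgt h1 = vB -> src h2 = vA /\ tgt h2 = vD ->
  src h3 = vB /\ tgt h3 = vC -> src h4 = vC /\ tgt h4 = vD ->
  ~~ odd (crossings l h1 + crossings l h2 + crossings l h3 + crossings l h4).
Proof.
move=> plN gl l0 [iA iB iC iD] [s1 t1] [s2 t2] [s3 t3] [s4 t4].
rewrite !oddD !(odd_crossings plN gl l0) ?s1 ?s2 ?s3 ?s4 ?t1 ?t2 ?t3 ?t4 //.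
(* Each of the four vertices is an end of exactly two sides, so its contribution cancels. *)
rewrite -!big_split /= big1 // => j _.
by do 4 case: (_ && _).
Qed.

Theorem lemma6p1 (R : realType) (k n : nat) (k_gt0 : (0 < k)%N) (k_lt_n : (k < n)%N)
    (D : set (R * R)) (N : network R n) (plN : plabic_network k D N)
    (l : (R * R)%type) (gl : gauge_direction D N l)
    (vA vB vC vD : vert N) (h1 h2 h3 h4 e1 e2 e3 e4 : edge N)
    (sq : square D vA vB vC vD h1 h2 h3 h4 e1 e2 e3 e4)
    (V : vectType R) (B : 'I_n -> V)
    (freeB : free [seq B j | j <- enum 'I_n & sink N j])
    (F F' : edge N -> V)
    (evF : edge_vectors l B F)
    (evF' : edge_vectors (N := square_move vA vB vC vD h1 h2 h3 h4) l B F')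
    (same_outside : forall e, e \notin [:: h1; h2; h3; h4] -> F' e = F e) :
  let N' := square_move vA vB vC vD h1 h2 h3 h4 in
  let a (h : edge N) := weight h in
  let a' (h : edge N') := weight h in
  let i (h : edge N) : int := (crossings l h)%:Z in
  let w := wind l in
  let g (h : edge N) := gamma2 l (evec h) in
  [/\ F' h4 =
        (a' h4 / a h3 *
          (-1) ^ (i h3 + i h4 + g h4 + w (evec h3) (evec h4) + 1)) *: F h3
        + (a' h4 * (-1) ^ (i h4 + g h4)) *: F h4,
      F' h2 =
        (a h1 * (-1) ^ (i h1 + g h4 + w (evec h2) (- evec h4)
                        + w (evec h3) (evec h4) + 1)) *: F h3
        + (a h2 / a h4 * (-1) ^ (1 + i h2 + i h4 + g h4
                                 + w (evec h2) (- evec h4))) *: F h4,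
      F' h1 =
        (a' h1 * (-1) ^ (i h1 + w (- evec h1) (evec h2))) *: F' h2 &
      F' h3 =
        ((-1) ^ (i h3 + i h4 + g h4 + w (evec h3) (evec h4) + 1)
          * (a h2 / a h1)) *: F' h4].
Proof.
move=> N' a a' i w g.
case: sq => uABCD iABCD [dA dB dC dD] [wA wC] [wB wD]
  e_h1 e_h2 e_h3 e_h4 _ _ e3D [e4C e4h4] [fF [Fface frF RAB RBC [RCD RDA]]].
have [iA iB iC iD] := iABCD.
have [[s1 t1] [s2 t2] [s3 t3] [s4 t4]] := And4 e_h1 e_h2 e_h3 e_h4.
have /and4P[+ + nCD _] := uABCD.
rewrite !inE !negb_or => /and3P[nAB nAC nAD] /andP[nBC nBD].
rewrite inE in nCD.
have nsrc (x y : edge N) : src x != src y -> x != y by apply: contraNneq => ->.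
have n12 : h1 != h2 by apply: contraNneq nBD => e; rewrite -t1 -t2 e.
have n13 : h1 != h3 by apply: nsrc; rewrite s1 s3.
have n14 : h1 != h4 by apply: nsrc; rewrite s1 s4.
have n23 : h2 != h3 by apply: nsrc; rewrite s2 s3.
have n24 : h2 != h4 by apply: nsrc; rewrite s2 s4.
have n34 : h3 != h4 by apply: nsrc; rewrite s3 s4.
have [e31 e32 e33 e34] : [/\ e3 != h1, e3 != h2, e3 != h3 & e3 != h4].
  by split; apply: nsrc; rewrite e3D ?s1 ?s2 ?s3 ?s4 eq_sym.
have [e41 e42 e43] : [/\ e4 != h1, e4 != h2 & e4 != h3].
  by split; apply: nsrc; rewrite e4C ?s1 ?s2 ?s3 eq_sym.
have mv1 : h1 \in [:: h1; h4] by rewrite inE eqxx.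
have mv4 : h4 \in [:: h1; h4] by rewrite !inE eqxx orbT.
have mv2 : (h2 \in [:: h1; h4]) = false.
  by rewrite !inE eq_sym (negPf n12) (negPf n24).
have mv3 : (h3 \in [:: h1; h4]) = false.
  by rewrite !inE eq_sym (negPf n13) (negPf n34).
have mve3 : (e3 \in [:: h1; h4]) = false by rewrite !inE (negPf e31) (negPf e34).
have mve4 : (e4 \in [:: h1; h4]) = false by rewrite !inE (negPf e41) (negPf e4h4).
(* The outer edges [e3] and [e4] carry the vectors that link the systems before and after the
   move. *)
have Fe3 : F' e3 = F e3.
  by apply: same_outside; rewrite !inE (negPf e31) (negPf e32) (negPf e33).
have Fe4 : F' e4 = F e4.
  by apply: same_outside; rewrite !inE (negPf e41) (negPf e42) (negPf e43).
have lh1 : orient (evec h1) l != 0.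
  by apply: (gd_parallel gl); rewrite ?s1 ?t1.
have l0 : l != 0.
  by move: lh1; rewrite sgz_eq0 crossC oppr_eq0; exact: cross_neq0l.
have inC2 : {in [:: h4; e4], forall e : edge N, src e == vC}.
  by move=> e; rewrite !inE => /orP[] /eqP ->; apply/eqP.
have cC1 : indeg vC = 1%N := pn_white plN iC wC.
have cD1 : outdeg vD = 1%N := pn_black plN iD wD.
have uC2 : uniq [:: h4; e4] by rewrite /= inE eq_sym e4h4.
have uD2 : uniq [:: h4; h2] by rewrite /= inE eq_sym n24.
(* Colour and degree fix the numbers of incoming and outgoing edges, so the known edges are all of
   them. *)
have atC e : incident vC e -> e \in [:: h3; h4; e4].
  have m3 : {in [:: h3], forall e : edge N, tgt e == vC}.
    by move=> x; rewrite inE => /eqP ->; apply/eqP.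
  have cC2 : outdeg vC = 2%N by move: dC; rewrite /deg cC1 => -[].
  case/orP => [/(mem_of_card uC2 inC2 cC2)|/(mem_of_card (s := [:: h3]) isT m3 cC1)].
    by rewrite !inE => /orP[] ->; rewrite !orbT.
  by rewrite !inE => ->.
have atD e : incident vD e -> e \in [:: h4; h2; e3].
  have m3 : {in [:: e3], forall e : edge N, src e == vD}.
    by move=> x; rewrite inE => /eqP ->; apply/eqP.
  have m2 : {in [:: h4; h2], forall e : edge N, tgt e == vD}.
    by move=> x; rewrite !inE => /orP[] /eqP ->; apply/eqP.
  have cD2 : indeg vD = 2%N by move: dD; rewrite /deg cD1 addn1 => -[].
  case/orP => [/(mem_of_card (s := [:: e3]) isT m3 cD1)|/(mem_of_card uD2 m2 cD2)].
    by rewrite !inE => ->; rewrite !orbT.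
  by rewrite !inE => /orP[] ->; rewrite ?orbT.
have [iC3 iC4 iCe] : [/\ incident vC h3, incident vC h4 & incident vC e4].
  by rewrite /incident t3 s4 e4C !eqxx orbT.
have [iD4 iD2 iDe] : [/\ incident vD h4, incident vD h2 & incident vD e3].
  by rewrite /incident t4 t2 e3D !eqxx !orbT.
have oC3 : outward vC h3 = - evec h3 by rewrite /outward s3 (negPf nBC).
have oC4 : outward vC h4 = evec h4 by rewrite /outward s4 eqxx.
have oCe : outward vC e4 = evec e4 by rewrite /outward e4C eqxx.
have oD4 : outward vD h4 = - evec h4 by rewrite /outward s4 (negPf nCD).
have oD2 : outward vD h2 = - evec h2 by rewrite /outward s2 (negPf nAD).
have oDe : outward vD e3 = evec e3 by rewrite /outward e3D eqxx.
have frne e : e != h1 -> e != h2 -> e != h3 -> e != h4 ->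
    forall x, frontier fF x -> exists2 h, h != e & drawn h x.
  move=> m1 m2 m3 m4 x; rewrite frF => -[[[|]|]|] hx;
    [exists h1 | exists h2 | exists h3 | exists h4] => //; by rewrite eq_sym.
have uC : uniq [:: h3; h4; e4] by rewrite /= !inE negb_or n34 ![_ == e4]eq_sym e43 e4h4.
have uD : uniq [:: h4; h2; e3].
  by rewrite /= !inE negb_or ![_ == e3]eq_sym [h4 == _]eq_sym n24 e34 e32.
have opC e (ie : incident vC e) := outward_transverse plN gl l0 iC ie.
have opD e (ie : incident vD e) := outward_transverse plN gl l0 iD ie.
(* The face walk arrives at C along [h3] and leaves along [h4]; at D it arrives along [h4] and
   leaves against [h2]. *)
have ccwC : ccw (- evec h3) (evec h4) (evec e4).
  rewrite -oC3 -oC4 -oCe.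
  apply: (ccw_face_corner plN iC iC3 iC4 iCe uC atC (opC _ iC3) Fface (frne _ _ _ _ _)) => //.
    by rewrite oC3 /evec s3 t3 opprB addrC subrK.
  by rewrite oC4 /evec s4 t4 addrC subrK.
have ccwD : ccw (- evec h4) (- evec h2) (evec e3).
  rewrite -oD4 -oD2 -oDe.
  apply: (ccw_face_corner plN iD iD4 iD2 iDe uD atD (opD _ iD4) Fface (frne _ _ _ _ _)) => //.
    by rewrite oD4 /evec s4 t4 opprB addrC subrK.
  by rewrite oD2 /evec s2 t2 opprB addrC subrK.
pose sg (z : int) : R := (-1) ^ z.
have kC : sg (w (evec h3) (evec e4)) * sg (w (- evec h4) (evec e4)) =
    - (sg (g h4) * sg (w (evec h3) (evec h4))).
  rewrite /sg -signD -{1}[evec h3]opprK wind_parity -?oC3 -?oC4 -?oCe;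
    rewrite ?opC ?oC3 ?oC4 ?oCe //.
  - by rewrite !signD expr1z opprK mulrN1.
  - by rewrite -oC3 -oC4; apply: (outward_antipar plN).
  - by rewrite -oC4 -oCe; apply: (outward_antipar plN); rewrite // eq_sym.
  - by rewrite -oC3 -oCe; apply: (outward_antipar plN).
have apD : antipar (- evec h4) (- evec h2).
  by rewrite -oD4 -oD2; apply: (outward_antipar plN); rewrite // eq_sym.
have oh2 : orient (- evec h2) l != 0 by rewrite -oD2 opD.
have oh4 : orient (- evec h4) l != 0 by rewrite -oD4 opD.
(* [wind_parity] gives [gamma2] at [- h2]; [wind_swap] moves it to [- h4], and passing to [h4] costs
   the minus sign. *)
have kD : sg (w (evec h2) (evec e3)) * sg (w (evec h4) (evec e3)) =
    - (sg (g h4) * sg (w (evec h2) (- evec h4))).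
  rewrite /sg mulrC -signD -{1}[evec h4]opprK -{1}[evec h2]opprK wind_parity //.
  - rewrite wind_swap // signD sign_gamma2N ?opprK ?mulNr //.
    by move: oh4; rewrite orientNl oppr_eq0.
  - by rewrite -oDe opD.
  - by rewrite -oD2 -oDe; apply: (outward_antipar plN); rewrite // eq_sym.
  - by rewrite -oD4 -oDe; apply: (outward_antipar plN).
have k4 : sg (i h1) * sg (i h2) * sg (i h3) * sg (i h4) = 1.
  apply: sign_crossings.
  exact: (even_square_crossings plN gl l0 iABCD e_h1 e_h2 e_h3 e_h4).
have mvi : {in [:: h1; h4], forall h : edge N, internal (src h) /\ internal (tgt h)}.
  by move=> h; rewrite !inE => /orP[] /eqP ->; rewrite ?s1 ?t1 ?s4 ?t4.
have cr e := crossings_square_move vA vB vC vD h2 h3 l e mvi.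
(* The relations before the move: C is white and D is black. *)
have eF3 := ev_white evF (e := h3) (f := h4) (g := e4).
rewrite t3 s4 e4C in eF3.
have {}eF3 := eF3 iC dC wC erefl erefl; rewrite eq_sym in eF3; have {}eF3 := eF3 e4h4.
have eF4 := ev_single evF (e := h4) (f := e3).
rewrite t4 e3D in eF4; have {}eF4 := eF4 iD (or_intror wD) erefl.
have ev := evec_square_move vA vB vC vD h1 h2 h3 h4.
have bA : vA \in [:: vA; vB; vC; vD] by rewrite !inE eqxx.
have bC : vC \in [:: vA; vB; vC; vD] by rewrite !inE eqxx !orbT.
have bD : vD \in [:: vA; vB; vC; vD] by rewrite !inE eqxx !orbT.
have a1' : a' h1 = weight h3 * weight h4 / (weight h2 + weight h1 * weight h3 * weight h4).
  by rewrite /a' /= eqxx.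
have a2' : a' h2 = weight h2 + weight h1 * weight h3 * weight h4.
  by rewrite /a' /= eq_sym (negPf n12) eqxx.
have a3' : a' h3 = weight h2 * weight h3 / (weight h2 + weight h1 * weight h3 * weight h4).
  by rewrite /a' /= ![h3 == _]eq_sym (negPf n13) (negPf n23) eqxx.
have a4' : a' h4 = weight h1 * weight h3 / (weight h2 + weight h1 * weight h3 * weight h4).
  by rewrite /a' /= ![h4 == _]eq_sym (negPf n14) (negPf n24) (negPf n34) eqxx.
(* The relations after the move: A and C are black, D is white. The one at A is already the third
   claim. *)
have eF1' := ev_single evF' (e := h1) (f := h2).
rewrite cr !ev /= mv1 mv2 s1 s2 bA wA -[if h1 == h1 then _ else _]/(a' h1) in eF1'.
have {}eF1' := eF1' iA (or_intror isT) erefl.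
have eF3' := ev_single evF' (e := h3) (f := e4).
rewrite cr !ev /= mv3 mve4 t3 e4C bC wC -[if h3 == h1 then _ else _]/(a' h3) in eF3'.
have {}eF3' := eF3' iC (or_intror isT) erefl.
have eF4' := ev_single evF' (e := h4) (f := e4).
rewrite cr !ev /= mv4 mve4 s4 e4C bC wC -[if h4 == h1 then _ else _]/(a' h4) in eF4'.
have {}eF4' := eF4' iC (or_intror isT) erefl.
have eF2' := ev_white evF' (e := h2) (f := e3) (g := h4).
rewrite cr !ev deg_square_move /= mv2 mve3 mv4 t2 t4 e3D bD wD
  -[if h2 == h1 then _ else _]/(a' h2) in eF2'.
have {}eF2' := eF2' iD dD isT erefl erefl e34.
rewrite Fe3 in eF2'; rewrite Fe4 in eF3' eF4'.
rewrite a2' !signD in eF2'; rewrite a3' signD in eF3'; rewrite a4' signD in eF4'.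
rewrite !signD in eF3; rewrite signD in eF4.
have [g4 g2 g3] := square_elimination (pn_weight plN h1) (pn_weight plN h2)
  (pn_weight plN h3) (pn_weight plN h4) (sign_sq _) (sign_sq _) (sign_sq _)
  (sign_sq _) (sign_sq _) (sign_sq _) (sign_sq _) (sign_sq _) (sign_sq _)
  kC kD k4 eF3 eF4 eF2' eF3' eF4'.
split; [| | by rewrite eF1' mulrC |]; rewrite ?a4' !signD expr1z //.
Qed.
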